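(* If $\rho:\mathbb{T}^1\to\mathbb{C}$ is a $C^{\infty}$-function, then for every $(\alpha,\beta)\in\mathcal{CD}_1$ the map $$F:\mathbb{T}^1\times\mathbb{C}\to\mathbb{T}^1\times\mathbb{C},\qquad F(x,z)=\left(x+\alpha, e^{2\pi i\beta}z+\rho(x)\right)$$ is reducible.
   Context: $\mathbb{T}^1=\mathbb{R}/\mathbb{Z}$. The pair $(\alpha,\beta)\in\mathbb{T}^1\times\mathbb{T}^1$ satisfies a type-1 Diophantine condition, written $(\alpha,\beta)\in\mathcal{CD}_1$, if there exist $C>0$ and $\tau\geq0$ such that $\big|e^{2\pi i(n\alpha-\beta)}-1\big|\geq\frac{C}{(1+|n|)^{1+\tau}}$ for every $n\in\mathbb{Z}$. The map $F$ is reducible if it admits a continuous invariant section, i.e. there is a continuous $\varphi:\mathbb{T}^1\to\mathbb{C}$ with $\varphi(x+\alpha)-e^{2\pi i\beta}\varphi(x)=\rho(x)$ for all $x\in\mathbb{T}^1$. *)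

(* Defs.v *)
(* MathComp-Analysis, over an arbitrary [R : realType]. *)
From HB Require Import structures.
From mathcomp Require Import all_boot all_order all_algebra.
From mathcomp Require Import generic_quotient ring_quotient complex.
From mathcomp Require Import all_classical all_reals all_analysis.

Set Implicit Arguments.
Unset Strict Implicit.
Unset Printing Implicit Defensive.

Import Order.TTheory GRing.Theory Num.Theory numFieldNormedType.Exports.

Local Open Scope classical_set_scope.
Local Open Scope ring_scope.
Local Open Scope complex_scope.
Local Open Scope quotient_scope.

(* [x \is a Num.int] unfolds to membership in [Num.int_num_subdef]. *)
Definition integers (R : realType) : zmodClosed R :=
  (@Num.int_num_subdef R : {pred R}).

Definition circle (R : realType) : Type :=
  quotient_topology (Quotient.quot (integers R)).

Section CircleStructures.
Variable R : realType.
Local Notation I := (integers R).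

HB.instance Definition _ := Topological.on (circle R).
HB.instance Definition _ := Quotient.on (circle R).
HB.instance Definition _ := GRing.isZmodule.Build (circle R)
  (@Quotient.addqA R I) (@Quotient.addqC R I)
  (@Quotient.add0q R I) (@Quotient.addNq R I).

Fact pi_circle_zmod_morphism : zmod_morphism \pi_(circle R).
Proof.
move=> s t; rewrite (Quotient.pi_add I s (- t)).
by congr (_ + _); exact: (Quotient.pi_opp I t).
Qed.
HB.instance Definition _ :=
  GRing.isZmodMorphism.Build R (circle R) \pi_(circle R)
    pi_circle_zmod_morphism.

End CircleStructures.

Section Circle.
Variable R : realType.
Implicit Types (x alpha beta : circle R) (rho phi : circle R -> R[i]).

Lemma pi_circle_eq (s t : R) :
  \pi_(circle R) s = \pi_(circle R) t <-> s - t \is a Num.int.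
Proof.
have -> : (s - t \is a Num.int) = (s - t \in integers R) by [].
by rewrite Quotient.idealrBE; split=> [?|/eqP //]; apply/eqP.
Qed.

(* e^{2 pi i x}: independent of the representative, see [cis_pi] below. *)
Definition cis x : R[i] :=
  cos (2 * pi * repr x) +i* sin (2 * pi * repr x).

(* C^infinity on the circle is read on the 1-periodic lift to R, for the real
   and imaginary parts separately. *)
Definition smooth rho : Prop :=
  forall (n : nat) (t : R),
    derivable (derive1n n (fun s : R => complex.Re (rho (\pi s)))) t 1 /\
    derivable (derive1n n (fun s : R => complex.Im (rho (\pi s)))) t 1.

Definition CD1 alpha beta : Prop :=
  exists C tau : R, [/\ 0 < C, 0 <= tau &
    forall n : int,
      (C / (1 + `|n|%:~R) `^ (1 + tau))%:C <= `|cis (alpha *~ n - beta) - 1|].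

Definition skew_product alpha beta rho (p : circle R * R[i]) :
  circle R * R[i] := (p.1 + alpha, cis beta * p.2 + rho p.1).

(* [R[i]^o] carries the topology of the complex modulus.  The section
   x |-> (x, phi x) is invariant when F maps its graph into itself. *)
Definition reducible (F : circle R * R[i] -> circle R * R[i]) : Prop :=
  exists phi, continuous (phi : circle R -> R[i]^o) /\
    forall x, (F (x, phi x)).2 = phi (F (x, phi x)).1.

Lemma reducible_skew_product alpha beta rho :
  reducible (skew_product alpha beta rho) <->
  exists phi, continuous (phi : circle R -> R[i]^o) /\
    forall x, phi (x + alpha) - cis beta * phi x = rho x.
Proof.
split=> -[phi [cphi inv]]; exists phi; split=> // x.
  by have /= <- := inv x; rewrite addrAC subrr add0r.
by rewrite /= -(inv x) addrC subrK.
Qed.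

Lemma cis_pi (t : R) :
  cis (\pi t) = cos (2 * pi * t) +i* sin (2 * pi * t).
Proof.
have : repr (\pi_(circle R) t) - t \is a Num.int.
  by apply/pi_circle_eq; rewrite reprK.
rewrite /cis => /intrP[m] /eqP; rewrite subr_eq addrC => /eqP ->.
rewrite mulrDr.
have cs (u : R) k : cos (u + 2 * pi * k%:R) = cos u /\
                    sin (u + 2 * pi * k%:R) = sin u.
  rewrite [2 * pi]mulr_natl mulr_natr.
  by split; rewrite (periodicn (@cosD2pi R), periodicn (@sinD2pi R)).
case: m => k; first by have [-> ->] := cs (2 * pi * t) k.
rewrite NegzE mulrNz mulrN.
have [<- <-] := cs (2 * pi * t - 2 * pi * k.+1%:R) k.+1.
by rewrite subrK.
Qed.

End Circle.

(* Main.v *)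
Require Import Defs.
From mathcomp Require Import all_boot all_order all_algebra.
From mathcomp Require Import complex.
From mathcomp Require Import all_classical all_reals all_analysis.
From mathcomp Require Import ring lra zify.

Set Implicit Arguments.
Unset Strict Implicit.
Unset Printing Implicit Defensive.

Import Order.TTheory GRing.Theory Num.Theory numFieldNormedType.Exports.

(**
The homological equation phi(x + alpha) - e(beta) phi(x) = rho(x), with
e(t) = exp(2 i pi t), is diagonal in the Fourier basis: a character e(n x) is
multiplied by d_n = e(n alpha) - e(beta), so phi is obtained from rho by
dividing the n-th Fourier coefficient by d_n.  The Diophantine condition says
that |d_n| is bounded below by an inverse power of 1 + |n|, while smoothness
makes the coefficients of rho decay faster than any power.  The quotients thus
remain summable and define a continuous function.

The argument below replaces Fourier integrals and series by discrete Fourier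
sums on the grids of mesh 1/N, N = 2^(m+1).  This asks for no integration
theory and no inversion theorem for Fourier series; three facts suffice.

- Decay ([dft_decay]).  The discrete transform turns the finite difference
  of step 1/N into multiplication by e(n/N) - 1, of modulus at least |n|/N
  when |n| <= N/2.  By the mean value theorem the k-th difference of a smooth
  periodic function is O(N^-k), so the n-th coefficient of the function itself
  is O(|n|^-k), uniformly in N.

- Aliasing ([dft_alias]).  The n-th coefficient on a grid is the sum of the
  n-th and (n + N)-th coefficients on the grid twice as fine.  Passing to the
  finer grid therefore changes each coefficient of index |n| <= N/2 by one
  high-frequency coefficient, which is O(N^-k).

- Interpolation ([trig_dft]).  The trigonometric polynomial built on the
  discrete coefficients agrees with the function at the nodes of the grid.

Let u_m be the trigonometric polynomial with coefficients divided by d_n on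
the grid of mesh 2^-(m+1).  If |d_n| >= C (1 + |n|)^-T, the first two facts
with k = T + 2 give |u_(m+1) - u_m| = O(2^-m) uniformly ([approx_step]), so
that u_m converges uniformly to a continuous periodic phi.  Since u_m solves
the equation whose right-hand side interpolates rho, phi solves the original
equation up to O(2^-m) at the nodes of the m-th grid.  The nodes become dense
and both sides are continuous, hence phi solves it everywhere
([cohomological_equation]).
*)

Import ComplexField.Normc.

Local Open Scope ring_scope.
Local Open Scope classical_set_scope.
Local Open Scope complex_scope.
Local Open Scope quotient_scope.

(** * Finite differences of smooth periodic functions *)

Definition fdiff (R V : zmodType) (h : R) (g : R -> V) : R -> V :=
  fun t => g (t + h) - g t.

Section FiniteDifferences.
Variable R : realType.
Implicit Types (g : R -> R) (h t B : R) (k : nat).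

Lemma fdiff_is_derive h g t :
  (forall s, derivable g s 1) ->
  is_derive t 1 (fdiff h g) (fdiff h (g^`()) t).
Proof.
move=> dg.
have dgt : is_derive (t + h) 1 g (g^`() (t + h)).
  by apply: DeriveDef; [exact: dg|rewrite derive1E].
have dg0 : is_derive t 1 g (g^`() t).
  by apply: DeriveDef; [exact: dg|rewrite derive1E].
have dsh : is_derive t 1 (fun s : R => s + h) (1 + 0) by apply: is_deriveD.
apply: is_deriveB.
have := @is_derive1_comp _ g (fun s : R => s + h) t _ _ dgt dsh.
by rewrite addr0 mulr1.
Qed.

(** Differences commute with differentiation, which lets the induction of
    [iter_fdiff_le] trade one difference for one derivative. *)
Lemma iter_fdiff_derive h k g :
  (forall s, derivable g s 1) ->
  (forall s, derivable (iter k (fdiff h) g) s 1) /\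
  (iter k (fdiff h) g)^`() = iter k (fdiff h) (g^`()).
Proof.
move=> dg; elim: k => [//|k [dk ek]]; split => [s|].
  by have := fdiff_is_derive h s dk; case.
apply/funext => t; rewrite !iterS -ek derive1E.
by have [_ ->] := fdiff_is_derive h t dk.
Qed.

Lemma fdiff_le h g B : 0 <= h -> (forall s, derivable g s 1) ->
  (forall s, `|g^`() s| <= B) -> forall t, `|fdiff h g t| <= B * h.
Proof.
move=> h0 dg Bg t; rewrite /fdiff.
have tth : t <= t + h by rewrite lerDl.
have [||c _ ->] := @MVT_segment R g (g^`()) t (t + h) tth.
- by move=> x _; apply: DeriveDef; [exact: dg|rewrite derive1E].
- apply: derivable_within_continuous => x _; exact: dg.
rewrite addrAC subrr add0r normrM (ger0_norm h0) ler_wpM2r //.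
Qed.

(** The k-th difference is estimated by applying the mean value theorem to the
    (k-1)-th difference, whose derivative is the (k-1)-th difference of g'. *)
Lemma iter_fdiff_le h k g B : 0 <= h ->
  (forall n s, derivable (g^`(n)) s 1) ->
  (forall s, `|g^`(k) s| <= B) ->
  forall t, `|iter k (fdiff h) g t| <= B * h ^+ k.
Proof.
move=> h0; elim: k g => [|k IHk] g dg Bg t.
  by rewrite expr0 mulr1; exact: Bg.
have [dk ek] := iter_fdiff_derive h k (dg 0).
rewrite iterS exprSr mulrA; apply: fdiff_le => // s.
rewrite ek; apply: IHk => [n s'|s']; rewrite -derive1Sn; [exact: dg|exact: Bg].
Qed.

(** Periodicity of a derivative says that its difference of step 1 vanishes;
    this difference is the derivative of the zero function. *)
Lemma derive1n_periodic g k : (forall n s, derivable (g^`(n)) s 1) ->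
  (forall t, g (t + 1) = g t) -> forall t, g^`(k) (t + 1) = g^`(k) t.
Proof.
move=> dg pg; elim: k => [//|k IHk] t.
apply/eqP; rewrite -subr_eq0 derive1nS.
have [_] := fdiff_is_derive 1 t (dg k).
have -> : fdiff 1 (g^`(k)) = cst 0.
  by apply/funext => s; rewrite /fdiff IHk subrr.
by rewrite derive_cst => ->.
Qed.

Lemma fracpart_itv t : 0 <= t - (Num.floor t)%:~R < 1.
Proof.
have /andP[l u] := floor_itv t.
by rewrite subr_ge0 l ltrBlDl -[1 in X in _ < X]/(1%:~R) -intrD.
Qed.

Lemma periodic_int (V : Type) (u : R -> V) : (forall t, u (t + 1) = u t) ->
  forall t (m : int), u (t + m%:~R) = u t.
Proof.
move=> pu t; elim/int_rec => [|n IHn|n IHn]; first by rewrite addr0.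
  by rewrite intS [1 + _]addrC intrD addrA pu.
by rewrite -[RHS]IHn -[LHS]pu intS opprD intrD addrA addrAC addrNK.
Qed.

Lemma periodic_bounded g : continuous g -> (forall t, g (t + 1) = g t) ->
  exists B, forall t, `|g t| <= B.
Proof.
move=> cg pg.
have [||c _ maxc] := @EVT_max R (fun t => `|g t|) 0 1; first exact: ler01.
  apply: continuous_subspaceT => x.
  by apply: continuous_comp; [exact: cg|exact: norm_continuous].
exists `|g c| => t.
rewrite -(subrK (Num.floor t)%:~R t) periodic_int //.
by apply: maxc; rewrite in_itv /=; case/andP: (fracpart_itv t) => -> /ltW.
Qed.

End FiniteDifferences.

(** * The real-valued complex modulus *)

Section ComplexModulus.
Variable R : realType.
Implicit Types (z w : R[i]).

Lemma normc_ge0 z : 0 <= normc z.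
Proof. by case: z => a b; rewrite /normc sqrtr_ge0. Qed.

Lemma normcB z w : normc (z - w) <= normc z + normc w.
Proof. by rewrite -[normc w]normcN le_normcD. Qed.

Lemma normc_real (x : R) : normc x%:C = `|x|.
Proof. by rewrite /normc /= expr0n /= addr0 sqrtr_sqr. Qed.

Lemma norm_normc z : `|z| = (normc z)%:C.
Proof. by case: z. Qed.

Lemma normcX z k : normc (z ^+ k) = normc z ^+ k.
Proof.
elim: k => [|k IHk]; first by rewrite !expr0 normc_real normr1.
by rewrite !exprS normcM IHk.
Qed.

Lemma normc_sum (I : Type) (r : seq I) (P : pred I) (F : I -> R[i]) :
  normc (\sum_(i <- r | P i) F i) <= \sum_(i <- r | P i) normc (F i).
Proof.
elim/big_ind2: _ => [|x a y b xa yb|//]; first by rewrite normc_real normr0.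
by apply: le_trans (le_normcD _ _) _; exact: lerD.
Qed.

Lemma normc_ge_Re z : `|complex.Re z| <= normc z.
Proof. by have := complex.normc_ge_Re z; rewrite norm_normc lecR. Qed.

Lemma normc_ge_Im z : `|complex.Im z| <= normc z.
Proof.
case: z => a b; rewrite /normc /= -sqrtr_sqr ler_wsqrtr //.
by rewrite lerDr sqr_ge0.
Qed.

Lemma normc_le_ReIm z : normc z <= `|complex.Re z| + `|complex.Im z|.
Proof.
rewrite [z in normc z]complexE; apply: le_trans (le_normcD _ _) _.
rewrite normcM !normc_real.
have -> : normc ('i%C : R[i]) = 1 by rewrite /normc expr0n add0r expr1n sqrtr1.
by rewrite mul1r.
Qed.

End ComplexModulus.

(** * The exponential e(t) *)

Section Exponential.
Variable R : realType.
Implicit Types (s t : R).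

Definition ecirc t : R[i] := cos (2 * pi * t) +i* sin (2 * pi * t).

Lemma ecirc0 : ecirc 0 = 1.
Proof. by rewrite /ecirc mulr0 cos0 sin0. Qed.

Lemma ecircD s t : ecirc (s + t) = ecirc s * ecirc t.
Proof.
rewrite /ecirc mulrDr cosD sinD; simpc.
by congr (_ +i* _); rewrite addrC [sin _ * _]mulrC.
Qed.

Lemma ecircN t : ecirc t * ecirc (- t) = 1.
Proof. by rewrite -ecircD subrr ecirc0. Qed.

Lemma ecircMn t n : ecirc (t *+ n) = ecirc t ^+ n.
Proof.
elim: n => [|n IHn]; first by rewrite mulr0n ecirc0.
by rewrite mulrS ecircD IHn exprS.
Qed.

Lemma normc_ecirc t : normc (ecirc t) = 1.
Proof. by rewrite /normc /ecirc cos2Dsin2 sqrtr1. Qed.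

Lemma ecirc_int (m : int) : ecirc m%:~R = 1.
Proof.
rewrite -ecirc0 /ecirc -!cis_pi; congr cis.
by apply/pi_circle_eq; rewrite subr0 intr_int.
Qed.

Lemma ecircDint t (m : int) : ecirc (t + m%:~R) = ecirc t.
Proof. by rewrite ecircD ecirc_int mulr1. Qed.

Lemma ecirc_half : ecirc (- (1 / 2)) = -1.
Proof.
have pi_half : 2 * pi * (1 / 2) = pi :> R by lra.
rewrite /ecirc mulrN pi_half cosN sinN cospi sinpi oppr0.
by rewrite -[-1 +i* 0]/((-1)%:C) rmorphN1.
Qed.

Lemma continuous_ecirc_Re : continuous (fun t : R => complex.Re (ecirc t)).
Proof.
move=> t; apply: continuous_comp; last exact: continuous_cos.
exact: mulrl_continuous.
Qed.

Lemma continuous_ecirc_Im : continuous (fun t : R => complex.Im (ecirc t)).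
Proof.
move=> t; apply: continuous_comp; last exact: continuous_sin.
exact: mulrl_continuous.
Qed.

(** As cos decreases on [0, pi], it is at least 1/2 on the whole of [0, x], and
    the mean value theorem applies. *)
Lemma sin_ge_half (x : R) : 0 <= x <= pi -> 1 / 2 <= cos x -> x / 2 <= sin x.
Proof.
move=> /andP[x0 xpi] cx.
have [|c c_itv] := @MVT_segment R (@sin R) (@cos R) 0 x x0.
  by apply: continuous_subspaceT => y; exact: continuous_sin.
rewrite sin0 !subr0 => ->; rewrite mulrC ler_wpM2r //.
move: c_itv; rewrite in_itv /= => /andP[c0 cx'].
rewrite -div1r; apply: le_trans cx _.
rewrite leNgt ltr_cos ?in_itv /= -?leNgt ?c0 ?x0 ?xpi //.
exact: le_trans xpi.
Qed.

(** While the cosine of 2 pi t is at least 1/2, the sine is at least t;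
    otherwise the real part of e(t) - 1 is at least 1/2 in modulus. *)
Lemma ecirc_sub1_ge_pos t : 0 <= t <= 1 / 2 -> t <= normc (ecirc t - 1).
Proof.
move=> /andP[t0 t2]; have pi2 := pi_ge2 R.
have x_itv : 0 <= 2 * pi * t <= pi.
  apply/andP; split; first by rewrite !mulr_ge0 // pi_ge0.
  rewrite -[leRHS]mulr1 -[2 * pi * t]mulrA [2 * _]mulrC -mulrA.
  by rewrite ler_wpM2l ?pi_ge0 //; lra.
have [cx|cx] := leP (1 / 2) (cos (2 * pi * t)).
- apply: le_trans (normc_ge_Im _); rewrite /ecirc /= subr0.
  apply: le_trans (ler_norm _); apply: le_trans (sin_ge_half x_itv cx).
  by nra.
- apply: le_trans (normc_ge_Re _); rewrite /ecirc /= ler0_norm; lra.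
Qed.

(** The constant 1 in front of |t| is what makes the powers of N cancel exactly
    in [dft_decay]. *)
Lemma ecirc_sub1_ge t : `|t| <= 1 / 2 -> `|t| <= normc (ecirc t - 1).
Proof.
move=> t2; have [t0|t0] := leP 0 t.
  move: t2; rewrite (ger0_norm t0) => t2.
  by apply: ecirc_sub1_ge_pos; rewrite t0.
have -> : ecirc t - 1 = - (ecirc t * (ecirc (- t) - 1)).
  by rewrite mulrBr ecircN mulr1 opprB.
rewrite normcN normcM normc_ecirc mul1r.
move: t2; rewrite (ltr0_norm t0) => t2.
by apply: ecirc_sub1_ge_pos; rewrite t2 oppr_ge0 ltW.
Qed.

Lemma ecirc_neq1 t : 0 < t < 1 -> ecirc t != 1.
Proof.
move=> /andP[t0 t1]; apply/eqP => et.
have [t2|t2] := leP t (1 / 2).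
  have := @ecirc_sub1_ge_pos t; rewrite t2 (ltW t0) et subrr normc_real normr0.
  by move=> /(_ isT); rewrite leNgt t0.
have := @ecirc_sub1_ge (t - 1); rewrite -[t - 1]/(t + (-1)%:~R) ecircDint et.
rewrite subrr normc_real normr0 ltr0_norm; lra.
Qed.

End Exponential.

(** * Finite sums over a period *)

Section CircularSums.

Lemma big_shift1 (V : zmodType) (N : nat) (F : nat -> V) : F N = F 0 ->
  \sum_(0 <= l < N) F l.+1 = \sum_(0 <= l < N) F l.
Proof.
move=> FN; apply: (addrI (F 0)).
by rewrite -big_nat_recl // big_nat_recr //= FN addrC.
Qed.

Lemma big_shift (V : zmodType) (N j : nat) (F : nat -> V) :
  (forall l, F (l + N)%N = F l) ->
  \sum_(0 <= l < N) F (l + j)%N = \sum_(0 <= l < N) F l.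
Proof.
move=> FN; elim: j => [|j <-]; first by under eq_bigr do rewrite addn0.
rewrite -(@big_shift1 _ _ (fun l => F (l + j)%N)); last by rewrite addnC FN.
by under eq_bigr do rewrite addnS.
Qed.

(** Modulo 2M the frequencies -(i+1), i < M, are M, ..., 2M - 1 in reverse
    order. *)
Lemma big_symmetric (V : zmodType) (M : nat) (F : int -> V) :
  (forall n, F (n + (2 * M)%N%:Z) = F n) ->
  \sum_(0 <= i < M) (F (Posz i) + F (Negz i)) =
  \sum_(0 <= i < 2 * M) F (Posz i).
Proof.
move=> FN; rewrite big_split /= [RHS](@big_cat_nat _ _ _ M) /= //; last first.
  by rewrite mul2n -addnn leq_addr.
congr (_ + _).
have -> : \sum_(M <= i < 2 * M) F (Posz i) = \sum_(0 <= i < M) F (Posz (i + M)).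
  by rewrite -{1}[M]add0n big_addn mul2n -addnn addnK.
rewrite [RHS]big_nat_rev /= add0n.
apply: eq_big_nat => i /andP[_ iM]; rewrite -FN; congr F.
by rewrite NegzE; lia.
Qed.

Lemma sum_unity_root (K : fieldType) (z : K) N : z ^+ N = 1 -> z != 1 ->
  \sum_(0 <= i < N) z ^+ i = 0.
Proof.
move=> zN z1; have := subrX1 z N.
rewrite zN subrr big_mkord => /esym/eqP; rewrite mulf_eq0 subr_eq0 (negbTE z1).
by move/eqP.
Qed.

End CircularSums.

(** * Discrete Fourier coefficients *)

Section DiscreteFourier.
Variable R : realType.
Implicit Types (g : R -> R[i]) (N M : nat) (n : int) (a : int -> R[i]).

Definition dft N g n : R[i] := N%:R^-1 *
  \sum_(0 <= l < N) g (l%:R / N%:R) * ecirc (- (n%:~R * (l%:R / N%:R))).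

Lemma dft_fdiff N g n : (0 < N)%N -> (forall t, g (t + 1) = g t) ->
  dft N (fdiff N%:R^-1 g) n = (ecirc (n%:~R / N%:R) - 1) * dft N g n.
Proof.
move=> N0 pg; have N0' : N%:R != 0 :> R by rewrite pnatr_eq0 -lt0n.
rewrite mulrBl mul1r /dft mulrCA -mulrBr; congr (_ * _).
under eq_bigr do rewrite mulrBl.
rewrite sumrB; congr (_ - _).
rewrite -(@big_shift1 _ _
  (fun l => g (l%:R / N%:R) * ecirc (- (n%:~R * (l%:R / N%:R))))).
  rewrite big_distrr /=; apply: eq_bigr => l _.
  rewrite [RHS]mulrCA -ecircD.
  have -> : l%:R / N%:R + N%:R^-1 = l.+1%:R / N%:R :> R.
    by rewrite -natr1 mulrDl mul1r.
  congr (_ * ecirc _); rewrite -natr1; field; exact: N0'.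
have g10 : g 1 = g 0 by rewrite -(pg 0) add0r.
by rewrite mul0r mulr0 oppr0 ecirc0 divff // g10 !mulr1 -mulrNz ecirc_int mulr1.
Qed.

Lemma normc_dft_le N g n B : (0 < N)%N -> (forall t, normc (g t) <= B) ->
  normc (dft N g n) <= B.
Proof.
move=> N0 gB; have N0' : 0 < N%:R :> R by rewrite ltr0n.
rewrite /dft normcM; have -> : (N%:R^-1 : R[i]) = (N%:R^-1)%:C.
  by rewrite fmorphV rmorph_nat.
rewrite normc_real gtr0_norm ?invr_gt0 // ler_pdivrMl //.
apply: le_trans (normc_sum _ _ _) _.
apply: le_trans (_ : \sum_(0 <= l < N) B <= _).
  by apply: ler_sum => l _; rewrite normcM normc_ecirc mulr1.
by rewrite sumr_const_nat subn0 mulr_natl.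
Qed.

Lemma iter_fdiff_periodic k h g : (forall t, g (t + 1) = g t) ->
  forall t, iter k (fdiff h) g (t + 1) = iter k (fdiff h) g t.
Proof.
by move=> pg; elim: k => [//|k IHk] t; rewrite !iterS /fdiff addrAC !IHk.
Qed.

Lemma dft_iter_fdiff N g n k : (0 < N)%N -> (forall t, g (t + 1) = g t) ->
  dft N (iter k (fdiff N%:R^-1) g) n =
  (ecirc (n%:~R / N%:R) - 1) ^+ k * dft N g n.
Proof.
move=> N0 pg; elim: k => [|k IHk]; first by rewrite expr0 mul1r.
rewrite iterS dft_fdiff //; last exact: iter_fdiff_periodic.
by rewrite IHk exprS mulrA.
Qed.

(** Summation by parts, iterated: the k-th power of e(n/N) - 1 times the
    coefficient is a coefficient of the k-th difference.  The powers of N on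
    the two sides cancel, so the bound is independent of the grid. *)
Lemma dft_decay N g n k B : (0 < N)%N -> (forall t, g (t + 1) = g t) ->
  (forall t, normc (iter k (fdiff N%:R^-1) g t) <= B * N%:R^-1 ^+ k) ->
  (2 * `|n| <= N)%N -> n != 0 ->
  normc (dft N g n) <= B / `|n|%N%:R ^+ k.
Proof.
move=> N0 pg gB nN n0; have N0' : 0 < N%:R :> R by rewrite ltr0n.
have n0' : 0 < `|n|%N%:R :> R by rewrite ltr0n absz_gt0.
have := normc_dft_le n N0 gB.
rewrite dft_iter_fdiff // normcM normcX => le1.
have nle : `|n|%N%:R / N%:R <= normc (ecirc (n%:~R / N%:R : R) - 1).
  have -> : `|n|%N%:R / N%:R = `|n%:~R / N%:R| :> R.
    by rewrite normrM normfV normr_nat -intr_norm -natr_absz.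
  apply: ecirc_sub1_ge.
  rewrite normrM normfV normr_nat -intr_norm -natr_absz ler_pdivrMr //.
  rewrite mul1r ler_pdivlMl // -natrM ler_nat //.
rewrite ler_pdivlMr ?exprn_gt0 //.
rewrite -(ler_pM2r (_ : 0 < N%:R^-1 ^+ k)); last by rewrite exprn_gt0 ?invr_gt0.
apply: le_trans le1; rewrite -mulrA -exprMn mulrC ler_wpM2r ?normc_ge0 //.
by rewrite lerXn2r // nnegrE ?normc_ge0 // divr_ge0 // ltW.
Qed.

Lemma dft_periodic N g n : (0 < N)%N -> dft N g (n + N%:Z) = dft N g n.
Proof.
move=> N0; have N0' : N%:R != 0 :> R by rewrite pnatr_eq0 -lt0n.
congr (_ * _); apply: eq_bigr => l _; congr (_ * _).
rewrite -[RHS](ecircDint _ (- l%:Z)); congr ecirc.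
rewrite intrD mulrDl opprD [N%:~R * _]mulrC divfK // mulrNz //.
Qed.

(** On the finer grid the characters n and n + N agree at even nodes and are
    opposite at odd ones, so adding the two coefficients keeps the even nodes,
    which form the coarser grid. *)
Lemma dft_alias N g n : (0 < N)%N ->
  dft N g n = dft (2 * N) g n + dft (2 * N) g (n + N%:Z).
Proof.
move=> N0; have N0' : N%:R != 0 :> R by rewrite pnatr_eq0 -lt0n.
have N0c : N%:R != 0 :> R[i] by rewrite pnatr_eq0 -lt0n.
rewrite /dft -mulrDr -big_split /=.
have step (F : nat -> R[i]) :
    \sum_(0 <= l < 2 * N) F l = \sum_(0 <= l < N) (F (2 * l)%N + F (2 * l).+1).
  elim: (N) => [|m IHm]; first by rewrite muln0 !big_geq.
  rewrite mulnS [RHS]big_nat_recr //= -IHm !add2n !big_nat_recr //=.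
  by rewrite addrA.
suff -> : \sum_(0 <= l < 2 * N)
    (g (l%:R / (2 * N)%:R) * ecirc (- (n%:~R * (l%:R / (2 * N)%:R))) +
     g (l%:R / (2 * N)%:R) * ecirc (- ((n + N%:Z)%:~R * (l%:R / (2 * N)%:R)))) =
  2 * \sum_(0 <= l < N) g (l%:R / N%:R) * ecirc (- (n%:~R * (l%:R / N%:R))).
  by rewrite natrM; field.
rewrite step big_distrr /=; apply: eq_bigr => l _.
have -> : (2 * l)%N%:R / (2 * N)%N%:R = l%:R / N%:R :> R.
  by rewrite !natrM -mulf_div divff ?mul1r // pnatr_eq0.
have -> : ecirc (- ((n + N%:Z)%:~R * (l%:R / N%:R))) =
          ecirc (- (n%:~R * (l%:R / N%:R))) :> R[i].
  rewrite -[RHS](ecircDint _ (- l%:Z)); congr ecirc.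
  by rewrite intrD mulrDl opprD [N%:~R * _]mulrC divfK // mulrNz.
set x := (2 * l).+1%:R / _.
have -> : ecirc (- ((n + N%:Z)%:~R * x)) = - ecirc (- (n%:~R * x)) :> R[i].
  have Nx : N%:R * x = l%:R + 1 / 2 :> R.
    by rewrite /x natrM -natr1 natrM; field.
  rewrite -[RHS]mulN1r -(ecirc_half R) -ecircD -[RHS](ecircDint _ (- l%:Z)).
  by congr ecirc; rewrite intrD mulrDl Nx mulrNz -pmulrn; ring.
by ring.
Qed.

(** The symmetric range of frequencies [-M, M) is written with the two
    constructors of [int], as the pairs i, -(i+1) for i < M.  This makes the
    change of range from M to 2M a plain splitting of a sum over naturals. *)
Definition trig M a (t : R) : R[i] :=
  \sum_(0 <= i < M) (a (Posz i) * ecirc ((Posz i)%:~R * t) +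
                      a (Negz i) * ecirc ((Negz i)%:~R * t)).

(** Exchanging the sums and translating the node index by j leaves, for each
    l < N, the sum of the powers of e(-l/N), which vanishes unless l = 0. *)
Lemma trig_dft M g j : (0 < M)%N -> (forall t, g (t + 1) = g t) ->
  trig M (dft (2 * M) g) (j%:R / (2 * M)%:R) = g (j%:R / (2 * M)%:R).
Proof.
move=> M0 pg; set N := (2 * M)%N.
have N0 : (0 < N)%N by rewrite muln_gt0.
have N0' : N%:R != 0 :> R by rewrite pnatr_eq0 -lt0n.
have N0c : N%:R != 0 :> R[i] by rewrite pnatr_eq0 -lt0n.
rewrite /trig (@big_symmetric _ M
  (fun n : int => dft N g n * ecirc (n%:~R * (j%:R / N%:R)))); last first.
  move=> n; rewrite dft_periodic //; congr (_ * _).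
  rewrite intrD mulrDl [N%:~R * _]mulrC divfK //.
  exact: (ecircDint _ j%:Z).
pose G l : R[i] := \sum_(0 <= i < N)
  g (l%:R / N%:R) * ecirc (i%:R * (j%:R / N%:R) - i%:R * (l%:R / N%:R)).
transitivity (N%:R^-1 * \sum_(0 <= l < N) G l).
  rewrite exchange_big /= big_distrr /=; apply: eq_bigr => i _.
  rewrite -mulrA; congr (_ * _); rewrite big_distrl /=; apply: eq_bigr => l _.
  by rewrite -mulrA -ecircD addrC.
rewrite -(@big_shift _ N j G); last first.
  move=> l; apply: eq_bigr => i _.
  have e : (l + N)%:R / N%:R = l%:R / N%:R + 1 :> R.
    by rewrite natrD mulrDl divff.
  rewrite e pg; congr (_ * _).
  rewrite -[RHS](ecircDint _ (- i%:Z)); congr ecirc.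
  by rewrite mulrDr mulr1 opprD addrA mulrNz.
rewrite (bigD1_seq 0) ?mem_index_iota ?iota_uniq //= big1_seq ?addr0.
  rewrite add0n /G; under eq_bigr do rewrite subrr ecirc0 mulr1.
  by rewrite sumr_const_nat subn0 -[X in _ * X]mulr_natl mulKf.
move=> l /andP[l0]; rewrite mem_index_iota /= => lN.
rewrite /G -big_distrr /=.
under eq_bigr do rewrite -mulrBr -mulrBl natrD addrC opprD addrNK mulNr.
pose z : R[i] := ecirc (- (l%:R / N%:R)).
rewrite (eq_bigr (fun i => z ^+ i)); last first.
  by move=> i _; rewrite /z -ecircMn; congr ecirc; rewrite -[RHS]mulr_natl.
rewrite sum_unity_root ?mulr0 //.
  rewrite /z -ecircMn.
  have -> : - (l%:R / N%:R) *+ N = (- l%:Z)%:~R :> R.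
    by rewrite -[LHS]mulr_natr mulNr divfK // mulrNz.
  exact: ecirc_int.
apply/eqP => z1; have := ecircN (l%:R / N%:R : R).
rewrite -/z z1 mulr1 => /eqP; apply/negP; apply: ecirc_neq1.
apply/andP; split; first by rewrite divr_gt0 // ltr0n // lt0n.
by rewrite ltr_pdivrMr ?ltr0n // mul1r ltr_nat.
Qed.

End DiscreteFourier.

(** * Dyadic approximate solutions *)

Section DyadicApproximants.
Variable R : realType.
Implicit Types (g : R -> R[i]) (a d : int -> R[i]) (M : nat).

Lemma iter_fdiff_Re k h g t :
  complex.Re (iter k (fdiff h) g t) =
  iter k (fdiff h) (fun s => complex.Re (g s)) t.
Proof.
elim: k t => [//|k IHk] t; rewrite !iterS /fdiff -!IHk.
by case: (iter _ _ _ _) (iter _ _ _ _) => a b [c e].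
Qed.

Lemma iter_fdiff_Im k h g t :
  complex.Im (iter k (fdiff h) g t) =
  iter k (fdiff h) (fun s => complex.Im (g s)) t.
Proof.
elim: k t => [//|k IHk] t; rewrite !iterS /fdiff -!IHk.
by case: (iter _ _ _ _) (iter _ _ _ _) => a b [c e].
Qed.

Lemma periodic_smooth_fdiff_le (u : R -> R) k :
  (forall n s, derivable (u^`(n)) s 1) -> (forall t, u (t + 1) = u t) ->
  exists B, forall h t, 0 <= h -> `|iter k (fdiff h) u t| <= B * h ^+ k.
Proof.
move=> du pu.
have [|B HB] := @periodic_bounded R (derive1n k u) _ (derive1n_periodic k du pu).
  by move=> t; apply/differentiable_continuous/derivable1_diffP/du.
by exists B => h t h0; apply: iter_fdiff_le.
Qed.

Lemma smooth_fdiff_le g k :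
  (forall n s, derivable (derive1n n (fun s => complex.Re (g s))) s 1) ->
  (forall n s, derivable (derive1n n (fun s => complex.Im (g s))) s 1) ->
  (forall t, g (t + 1) = g t) ->
  exists2 B, 0 <= B & forall h t, 0 <= h ->
    normc (iter k (fdiff h) g t) <= B * h ^+ k.
Proof.
move=> dRe dIm pg.
have [|B1 H1] := periodic_smooth_fdiff_le k dRe; first by move=> t; rewrite pg.
have [|B2 H2] := periodic_smooth_fdiff_le k dIm; first by move=> t; rewrite pg.
have le h t : 0 <= h -> normc (iter k (fdiff h) g t) <= (B1 + B2) * h ^+ k.
  move=> h0; apply: le_trans (normc_le_ReIm _) _.
  by rewrite iter_fdiff_Re iter_fdiff_Im mulrDl lerD ?H1 ?H2.
exists (B1 + B2) => //.
by have := le 1 0 ler01; rewrite expr1n mulr1; apply: le_trans; exact: normc_ge0.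
Qed.

Lemma trig_double_sub M a d D t :
  (forall i, (i < M)%N -> normc (d (Posz i) - a (Posz i)) <= D /\
                          normc (d (Negz i) - a (Negz i)) <= D) ->
  (forall i, (M <= i < 2 * M)%N -> normc (d (Posz i)) <= D /\
                                   normc (d (Negz i)) <= D) ->
  normc (trig (2 * M) d t - trig M a t) <= (4 * M)%:R * D.
Proof.
move=> lo hi; rewrite /trig.
have M2 : (M <= 2 * M)%N by rewrite mul2n -addnn leq_addr.
rewrite (@big_cat_nat _ _ _ M) //= addrAC -sumrB.
have pair (p q : R[i]) (s r : R) : normc p <= D -> normc q <= D ->
    normc (p * ecirc s + q * ecirc r) <= D *+ 2.
  move=> pD qD; apply: le_trans (le_normcD _ _) _.
  by rewrite !normcM !normc_ecirc !mulr1 mulr2n lerD.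
apply: le_trans (le_normcD _ _) _.
have -> : (4 * M)%:R * D = D *+ 2 *+ M + D *+ 2 *+ (2 * M - M) :> R.
  by rewrite mul2n -addnn addnK -!mulrnA -mulrnDr mulr_natl; congr (_ *+ _); lia.
apply: lerD; apply: le_trans (normc_sum _ _ _) _.
  apply: le_trans (_ : \sum_(0 <= i < M) D *+ 2 <= _); last first.
    by rewrite sumr_const_nat subn0.
  apply: ler_sum_nat => i /andP[_ iM]; have [l1 l2] := lo i iM.
  by rewrite opprD addrACA -!mulrBl; exact: pair.
apply: le_trans (_ : \sum_(M <= i < 2 * M) D *+ 2 <= _); last first.
  by rewrite sumr_const_nat.
by apply: ler_sum_nat => i iM; have [l1 l2] := hi i iM; exact: pair.
Qed.

Section Coefficients.
Variables (g : R -> R[i]) (k : nat) (B : R).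
Hypothesis pg : forall t, g (t + 1) = g t.
Hypothesis B0 : 0 <= B.
Hypothesis gB : forall h t, 0 <= h ->
  normc (iter k (fdiff h) g t) <= B * h ^+ k.

(** High frequencies of the grid of mesh 1/(4M): the upper bound 2M is the
    Nyquist limit required by [dft_decay]. *)
Lemma dft_decay_dyadic M n : (0 < M)%N -> (M <= `|n| <= 2 * M)%N ->
  normc (dft (2 * (2 * M)) g n) <= B / M%:R ^+ k.
Proof.
move=> M0 /andP[Mn nM].
have n0 : n != 0 by rewrite -absz_gt0; exact: leq_trans Mn.
have M0' : 0 < M%:R :> R by rewrite ltr0n.
apply: le_trans (@dft_decay _ _ _ _ k B _ pg _ _ n0) _.
- by rewrite !muln_gt0.
- by move=> t; apply: gB; rewrite invr_ge0.
- by rewrite leq_mul2l.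
rewrite ler_wpM2l // lef_pV2 ?posrE ?exprn_gt0 ?ltr0n ?absz_gt0 //.
by rewrite lerXn2r ?nnegrE ?ler_nat.
Qed.

(** By aliasing the difference is a single coefficient, of index n + 2M or
    equivalently n - 2M modulo 4M; the one closer to 0 lies between M and 2M
    in absolute value. *)
Lemma dft_double_sub M i : (i < M)%N ->
  normc (dft (2 * (2 * M)) g (Posz i) - dft (2 * M) g (Posz i)) <= B / M%:R ^+ k
  /\
  normc (dft (2 * (2 * M)) g (Negz i) - dft (2 * M) g (Negz i)) <= B / M%:R ^+ k.
Proof.
move=> iM; have M0 : (0 < M)%N by exact: leq_ltn_trans iM.
have M20 : (0 < 2 * M)%N by rewrite muln_gt0.
have M40 : (0 < 2 * (2 * M))%N by rewrite muln_gt0.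
rewrite !(dft_alias g _ M20) !opprD !addrA !subrr !add0r !normcN; split.
  (* i + 2M may exceed the Nyquist limit; i - 2M does not. *)
  rewrite -[_ + _](subrK (2 * (2 * M))%N%:Z) dft_periodic //.
  by apply: dft_decay_dyadic => //; lia.
by apply: dft_decay_dyadic => //; lia.
Qed.

End Coefficients.

Section SmallDivisors.
Variables (g : R -> R[i]) (T : nat) (B C : R) (d : int -> R[i]).
Hypothesis pg : forall t, g (t + 1) = g t.
Hypothesis B0 : 0 <= B.
Hypothesis gB : forall h t, 0 <= h ->
  normc (iter T.+2 (fdiff h) g t) <= B * h ^+ T.+2.
Hypothesis C0 : 0 < C.
Hypothesis dC : forall n : int, C <= (1 + `|n|%N%:R) ^+ T * normc (d n).

(** The solution for the trigonometric interpolant of g on the grid of mesh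
    2^-(m+1), with d n standing for the small divisors. *)
Definition approx m : R -> R[i] :=
  trig (2 ^ m) (fun n => dft (2 * 2 ^ m) g n / d n).

Lemma divisor_gt0 n : 0 < normc (d n).
Proof.
have := lt_le_trans C0 (dC n).
by rewrite pmulr_rgt0 // exprn_gt0 // ltr_wpDr.
Qed.

Lemma normc_div_le M z n D : (0 < M)%N -> (`|n| <= 2 * M)%N -> normc z <= D ->
  normc (z / d n) <= D * ((3 * M%:R) ^+ T / C).
Proof.
move=> M0 nM zD; have dn0 := divisor_gt0 n.
rewrite normcM normcV.
apply: ler_pM => //; rewrite ?invr_ge0 ?normc_ge0 //.
rewrite ler_pdivlMr // mulrC -ler_pdivlMr ?invr_gt0 // invrK.
apply: le_trans (dC n) _.
rewrite ler_wpM2r ?(ltW dn0) // lerXn2r ?nnegrE ?addr_ge0 ?mulr_ge0 //.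
by rewrite -natrM -mulrS ler_nat; lia.
Qed.

(** With M = 2^m, there are 4M terms, each a coefficient change O(M^-(T+2))
    times an inverse divisor O(M^T).  Taking T + 2 differences thus leaves
    O(1/M). *)
Lemma approx_step m t :
  normc (approx m.+1 t - approx m t) <= 4 * B * 3 ^+ T / C / 2 ^+ m.
Proof.
rewrite /approx expnS; set M := (2 ^ m)%N.
have M0 : (0 < M)%N by rewrite expn_gt0.
have M0' : M%:R != 0 :> R by rewrite pnatr_eq0 -lt0n.
have -> : 2 ^+ m = M%:R :> R by rewrite natrX.
have C0' : C != 0 by rewrite gt_eqF.
have -> : 4 * B * 3 ^+ T / C / M%:R =
    (4 * M)%:R * (B / M%:R ^+ T.+2 * ((3 * M%:R) ^+ T / C)).
  rewrite natrM exprMn !exprS; field; rewrite C0' M0' /=.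
  by rewrite expf_neq0.
apply: trig_double_sub => i iM.
  have [l1 l2] := dft_double_sub pg B0 gB iM.
  by rewrite -!mulrBl; split; apply: normc_div_le => //; lia.
by split; apply: normc_div_le => //; try lia; apply: dft_decay_dyadic => //; lia.
Qed.

End SmallDivisors.

Lemma trig_cohomological M (c d : int -> R[i]) (al be t : R) :
  (forall n, d n = ecirc (n%:~R * al) - ecirc be) -> (forall n, d n != 0) ->
  trig M (fun n => c n / d n) (t + al) - ecirc be * trig M (fun n => c n / d n) t =
  trig M c t.
Proof.
move=> dE d0; rewrite /trig big_distrr -sumrB /=; apply: eq_bigr => i _.
have term n : c n / d n * ecirc (n%:~R * (t + al)) -
    ecirc be * (c n / d n * ecirc (n%:~R * t)) = c n * ecirc (n%:~R * t).
  rewrite mulrDr ecircD.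
  have -> : ecirc (n%:~R * al) = d n + ecirc be by rewrite dE subrK.
  by field; exact: d0.
by rewrite -!term; ring.
Qed.

End DyadicApproximants.

(** * Geometric uniform limits *)

Section UniformLimit.
Variable R : realType.

(** The sequences v - e and v + e are monotone and enclose v, so the supremum
    of the former is the limit and the rate comes for free. *)
Lemma real_geometric_limit (v : nat -> R) K :
  (forall m, `|v m.+1 - v m| <= K / 2 ^+ m) ->
  exists L, forall m, `|L - v m| <= 2 * K / 2 ^+ m.
Proof.
move=> vK.
have p2 m : 0 < 2 ^+ m :> R by rewrite exprn_gt0.
have K0 : 0 <= K.
  by have := vK 0; rewrite expr0 divr1; exact: le_trans.
pose e m : R := 2 * K / 2 ^+ m.
have e0 m : 0 <= e m by rewrite divr_ge0 ?mulr_ge0 // ltW.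
have eS m : K / 2 ^+ m = e m - e m.+1.
  by rewrite /e exprS; have := lt0r_neq0 (p2 m); move: (2 ^+ m) => q q0; field.
have lo : {homo (fun m => v m - e m) : m n / (m <= n)%N >-> m <= n}.
  apply: homo_leq => // [y x z|m]; first lra.
  by have := vK m; rewrite eS ler_norml => /andP[]; lra.
have hi : {homo (fun m => v m + e m) : m n / (m <= n)%N >-> n <= m}.
  apply: homo_leq => // [y x z|m]; first lra.
  by have := vK m; rewrite eS ler_norml => /andP[]; lra.
pose S := range (fun m => v m - e m).
have ubS m : ubound S (v m + e m).
  move=> _ [n _ <-]; have := lo _ _ (leq_maxl n m); have := hi _ _ (leq_maxr n m).
  by have := e0 (maxn n m); lra.
have S0 : S !=set0 by exists (v 0 - e 0); exists 0.
exists (sup S) => m; rewrite -/(e m) ler_norml.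
have : sup S <= v m + e m by apply: ge_sup.
have : v m - e m <= sup S.
  by apply: ub_le_sup; [exists (v 0 + e 0); exact: ubS|exists m].
by move=> ? ?; apply/andP; split; lra.
Qed.

Lemma complex_geometric_limit (v : nat -> R[i]) K :
  (forall m, normc (v m.+1 - v m) <= K / 2 ^+ m) ->
  exists L, forall m, normc (L - v m) <= 4 * K / 2 ^+ m.
Proof.
move=> vK.
have [|x Hx] := @real_geometric_limit (fun m => complex.Re (v m)) K.
  move=> m; apply: le_trans (vK m); apply: le_trans (normc_ge_Re _).
  by case: (v m.+1) (v m) => a b [c d].
have [|y Hy] := @real_geometric_limit (fun m => complex.Im (v m)) K.
  move=> m; apply: le_trans (vK m); apply: le_trans (normc_ge_Im _).
  by case: (v m.+1) (v m) => a b [c d].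
exists (x +i* y) => m; apply: le_trans (normc_le_ReIm _) _.
have -> : 4 * K / 2 ^+ m = 2 * K / 2 ^+ m + 2 * K / 2 ^+ m :> R.
  by rewrite -mulrDl -mulrDl; congr (_ * _ / _); lra.
by apply: lerD; [have := Hx m|have := Hy m]; case: (v m).
Qed.

Lemma exists_dyadic_lt (K e : R) : 0 < e -> exists m, K / 2 ^+ m < e.
Proof.
move=> e0; exists (Num.truncn (K / e)).+1.
rewrite ltr_pdivrMr ?exprn_gt0 // mulrC -ltr_pdivrMr //.
apply: lt_le_trans (truncnS_gt _) _.
by rewrite -natrX ler_nat ltnW // ltn_expl.
Qed.

Lemma continuous_normcP (T : topologicalType) (u : T -> R[i]^o) (x : T) :
  {for x, continuous u} <->
  forall e : R, 0 < e -> \forall y \near x, normc (u x - u y) < e.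
Proof.
split=> [/cvgrPdist_lt cu e e0|cu].
  have := cu e%:C; rewrite ltcR => /(_ e0); apply: filterS => y.
  by rewrite norm_normc ltcR.
apply/cvgrPdist_lt => -[e1 e2]; rewrite ltcE /= => /andP[/eqP -> e0].
have := cu _ e0; apply: filterS => y.
by rewrite norm_normc -[e1 +i* 0]/(e1%:C) ltcR.
Qed.

Lemma continuous_ReIm (T : topologicalType) (u : T -> R[i]^o) :
  continuous (fun x => complex.Re (u x)) ->
  continuous (fun x => complex.Im (u x)) -> continuous u.
Proof.
move=> cRe cIm x; apply/continuous_normcP => e e0.
have e2 : 0 < e / 2 by rewrite divr_gt0.
have /cvgrPdist_lt/(_ _ e2) nRe := cRe x.
have /cvgrPdist_lt/(_ _ e2) nIm := cIm x.
near=> y.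
apply: le_lt_trans (normc_le_ReIm _) _.
rewrite (splitr e) ltrD //.
  have : `|complex.Re (u x) - complex.Re (u y)| < e / 2 by near: y.
  by case: (u x) (u y) => a b [c d].
have : `|complex.Im (u x) - complex.Im (u y)| < e / 2 by near: y.
by case: (u x) (u y) => a b [c d].
Unshelve. all: by end_near.
Qed.

Lemma continuous_ecirc : continuous (@ecirc R : R -> R[i]^o).
Proof.
by apply: continuous_ReIm; [exact: continuous_ecirc_Re|exact: continuous_ecirc_Im].
Qed.

Lemma continuous_trig M (a : int -> R[i]) :
  continuous (trig M a : R -> R[i]^o).
Proof.
have term (c : R[i]) (n : int) :
    continuous (fun t : R => c * ecirc (n%:~R * t) : R[i]^o).
  move=> t.
  apply: (@cvgM _ _ _ _ (fun=> c : R[i]^o)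
    (fun s : R => ecirc (n%:~R * s) : R[i]^o)); first exact: cvg_cst.
  apply: continuous_comp; first exact: mulrl_continuous.
  exact: continuous_ecirc.
elim: M => [|M IHM] t.
  by rewrite /trig; under eq_fun do rewrite big_geq //; exact: cvg_cst.
have -> : trig M.+1 a = fun t => trig M a t +
    (a (Posz M) * ecirc ((Posz M)%:~R * t) +
     a (Negz M) * ecirc ((Negz M)%:~R * t)).
  by apply/funext => s; rewrite /trig big_nat_recr.
apply: cvgD; first exact: IHM.
by apply: cvgD; exact: term.
Qed.

Lemma continuous_uniform_limit (u : nat -> R -> R[i]^o) (w : R -> R[i]^o) K :
  (forall m, continuous (u m)) ->
  (forall m t, normc (w t - u m t) <= K / 2 ^+ m) -> continuous w.
Proof.
move=> cu uw t; apply/continuous_normcP => e e0.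
have e3 : 0 < e / 3 by rewrite divr_gt0.
have [m Hm] := exists_dyadic_lt K e3.
have /continuous_normcP/(_ _ e3) := cu m t; apply: filterS => s ts.
have -> : w t - w s = (w t - u m t) + (u m t - u m s) - (w s - u m s) by ring.
apply: le_lt_trans (normcB _ _) _.
have := le_normcD (w t - u m t) (u m t - u m s).
have := uw m t; have := uw m s; lra.
Qed.

End UniformLimit.

(** * Solution of the equation *)

Section CohomologicalEquation.
Variable R : realType.

Lemma normc_le0 (z : R[i]) : (forall e, 0 < e -> normc z < e) -> z = 0.
Proof.
move=> ze; apply: eq0_normc; apply/eqP; rewrite eq_le normc_ge0 andbT.
by apply/ler_addgt0Pl => e e0; rewrite addr0 ltW // ze.
Qed.

Lemma trig_periodic M (a : int -> R[i]) t : trig M a (t + 1) = trig M a t.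
Proof.
by apply: eq_bigr => i _; rewrite !mulrDr !mulr1 !ecircDint.
Qed.

(** The dyadic points j / p, with p = 2^(m+1) and j the integer part of t p,
    converge to t, and the bounds at these points tend to 0. *)
Lemma continuous_zero_dyadic (w : R -> R[i]^o) K : continuous w ->
  (forall m j, normc (w (j%:R / 2 ^+ m.+1)) <= K / 2 ^+ m.+1) ->
  forall t, 0 <= t -> w t = 0.
Proof.
move=> cw wK t t0; apply: normc_le0 => e e0.
have e2 : 0 < e / 2 by rewrite divr_gt0.
have /continuous_normcP/(_ _ e2)/nbhs_ballP[r /= r0 Hr] := cw t.
have [m Hm] : exists m, (`|K| + 1) / 2 ^+ m.+1 < Num.min r (e / 2).
  have [|m Hm] := @exists_dyadic_lt R (`|K| + 1) (Num.min r (e / 2)).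
    by rewrite lt_min r0.
  exists m; apply: le_lt_trans Hm; rewrite ler_wpM2l ?addr_ge0 //.
  by rewrite lef_pV2 ?posrE ?exprn_gt0 // ler_weXn2l // ler1n.
set p := 2 ^+ m.+1 in Hm.
have p0 : 0 < p by rewrite exprn_gt0.
move: Hm; rewrite lt_min => /andP[Hr' He].
pose j := Num.truncn (t * p).
have /andP[jt tj] : j%:R <= t * p < j.+1%:R.
  by apply: truncn_itv; rewrite mulr_ge0 // ltW.
have K1 : 1 / p <= (`|K| + 1) / p.
  by rewrite ler_wpM2r ?invr_ge0 ?(ltW p0) // lerDr.
have near_t : ball t r (j%:R / p).
  rewrite -ball_normE /ball_ /=; apply: le_lt_trans Hr'; apply: le_trans K1.
  rewrite ler_pdivlMr // -{2}(gtr0_norm p0) -normrM mulrBl divfK ?gt_eqF //.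
  by rewrite ler_norml; move: tj; rewrite -natr1; lra.
have KK : K / p <= (`|K| + 1) / p.
  rewrite ler_wpM2r ?invr_ge0 ?(ltW p0) //.
  by have := ler_norm K; lra.
have := Hr _ near_t; have := wK m j; rewrite -/p.
have := le_normcD (w t - w (j%:R / p)) (w (j%:R / p)).
by rewrite subrK; lra.
Qed.

(** The equation on the line: the limit of the dyadic approximate solutions
    solves it up to O(2^-m) at the nodes j / 2^(m+1), hence on the half-line by
    continuity and everywhere by periodicity. *)
Lemma cohomological_equation (g : R -> R[i]) (al be C : R) (T : nat) :
  (forall n s, derivable (derive1n n (fun s => complex.Re (g s))) s 1) ->
  (forall n s, derivable (derive1n n (fun s => complex.Im (g s))) s 1) ->
  (forall t, g (t + 1) = g t) -> 0 < C ->
  (forall n : int, C <= (1 + `|n|%N%:R) ^+ T *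
    normc (ecirc (n%:~R * al) - ecirc be)) ->
  exists phi : R -> R[i]^o, [/\ continuous phi,
    forall t, phi (t + 1) = phi t &
    forall t, phi (t + al) - ecirc be * phi t = g t].
Proof.
move=> dRe dIm pg C0 dC.
have [B B0 gB] := smooth_fdiff_le T.+2 dRe dIm pg.
pose d (n : int) : R[i] := ecirc (n%:~R * al) - ecirc be.
pose u := approx g d.
pose K := 4 * (4 * B * 3 ^+ T / C).
have /choice[phi Hphi] : forall t, exists L,
    forall m, normc (L - u m t) <= K / 2 ^+ m.
  move=> t; apply: complex_geometric_limit => m.
  exact: (approx_step pg B0 gB C0 dC).
have cphi : continuous (phi : R -> R[i]^o).
  apply: (continuous_uniform_limit (u := u)) => // m; exact: continuous_trig.
have pphi t : phi (t + 1) = phi t.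
  apply/eqP; rewrite -subr_eq0; apply/eqP; apply: normc_le0 => e e0.
  have e2 : 0 < e / 2 by rewrite divr_gt0.
  have [m Hm] := exists_dyadic_lt K e2.
  have -> : phi (t + 1) - phi t =
            (phi (t + 1) - u m (t + 1)) - (phi t - u m t).
    by have -> : u m (t + 1) = u m t by [exact: trig_periodic]; ring.
  apply: le_lt_trans (normcB _ _) _.
  by have := Hphi (t + 1) m; have := Hphi t m; lra.
exists phi; split=> // t.
pose w s : R[i]^o := phi (s + al) - ecirc be * phi s - g s.
have cg : continuous (g : R -> R[i]^o).
  apply: continuous_ReIm => s; apply/differentiable_continuous/derivable1_diffP.
    exact: (dRe 0).
  exact: (dIm 0).
have cw : continuous w.
  move=> s; apply: cvgB; last exact: cg.
  apply: cvgB.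
    apply: continuous_comp; last exact: cphi.
    by apply: cvgD; [exact: cvg_id|exact: cvg_cst].
  apply: (@cvgM _ _ _ _ (fun=> ecirc be : R[i]^o) phi); first exact: cvg_cst.
  exact: cphi.
have wdy m j : normc (w (j%:R / 2 ^+ m.+1)) <= 4 * K / 2 ^+ m.+1.
  set s := j%:R / _.
  have us : u m (s + al) - ecirc be * u m s = g s.
    rewrite /u /approx trig_cohomological //; last first.
      by move=> n; apply/eqP => dn0; have := divisor_gt0 C0 dC n;
        rewrite -/(d n) dn0 normc_real normr0 ltxx.
    have -> : s = j%:R / (2 * 2 ^ m)%:R by rewrite /s -natrX expnS.
    by apply: trig_dft => //; rewrite expn_gt0.
  have -> : w s = (phi (s + al) - u m (s + al)) - ecirc be * (phi s - u m s).
    by rewrite /w -us; ring.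
  apply: le_trans (normcB _ _) _; rewrite normcM normc_ecirc mul1r.
  have -> : 4 * K / 2 ^+ m.+1 = K / 2 ^+ m + K / 2 ^+ m.
    rewrite exprS; have : 2 ^+ m != 0 :> R by rewrite expf_neq0.
    by move: (2 ^+ m) => q q0; field.
  by apply: lerD; exact: Hphi.
have w0 s : 0 <= s -> w s = 0.
  exact: (continuous_zero_dyadic (K := 4 * K)).
have pw s : w (s + 1) = w s by rewrite /w pg pphi [s + 1 + al]addrAC pphi.
apply/eqP; rewrite -subr_eq0 -/(w t) -(subrK (Num.floor t)%:~R t).
rewrite periodic_int // w0 //; by case/andP: (fracpart_itv t).
Qed.

End CohomologicalEquation.

Theorem proposition19 (R : realType) (rho : circle R -> R[i])
  (rho_smooth : smooth rho) (alpha beta : circle R)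
  (ab_CD1 : CD1 alpha beta) :
  reducible (skew_product alpha beta rho).
Proof.
apply/reducible_skew_product.
have [C [tau [C0 tau0 dC]]] := ab_CD1.
pose g t := rho (\pi_(circle R) t).
have piD1 (t : R) : \pi_(circle R) (t + 1) = \pi_(circle R) t.
  by apply/pi_circle_eq; rewrite addrAC subrr add0r; exact: (intr_int R 1).
pose T := (Num.truncn (1 + tau)).+1.
have [||||n|phi [cphi pphi phiE]] :=
    @cohomological_equation R g (repr alpha) (repr beta) C T.
- by move=> n s; have [] := rho_smooth n s.
- by move=> n s; have [] := rho_smooth n s.
- by move=> t; rewrite /g piD1.
- exact: C0.
- set a := repr alpha; set b := repr beta.
  have := dC n; rewrite norm_normc lecR ler_pdivrMr; last first.
    by rewrite powR_gt0 // ltr_pwDl.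
  have -> : alpha *~ n - beta = \pi_(circle R) (n%:~R * a - b).
    by rewrite mulrzl raddfB raddfMz /= !reprK.
  rewrite cis_pi -/(ecirc _) => dCn.
  have -> : ecirc (n%:~R * a) - ecirc b = ecirc b * (ecirc (n%:~R * a - b) - 1).
    by rewrite mulrBr mulr1 -ecircD [b + _]addrC subrK.
  rewrite normcM normc_ecirc mul1r mulrC; apply: le_trans dCn _.
  rewrite ler_wpM2l ?normc_ge0 // -powR_mulrn ?addr_ge0 // natr_absz.
  by apply: ler_powR; rewrite ?lerDl ?ler0z // ltW // truncnS_gt.
exists (phi \o repr); split.
  apply: repr_comp_continuous => // s t /eqP/pi_circle_eq/intrP[m st].
  by rewrite -(subrK t s) st addrC (periodic_int pphi).
move=> x /=.
have /intrP[m xm] : repr (x + alpha) - (repr x + repr alpha) \is a Num.int.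
  by apply/pi_circle_eq; rewrite raddfD /= !reprK.
have -> : repr (x + alpha) = repr x + repr alpha + m%:~R.
  by rewrite -xm [RHS]addrC subrK.
by rewrite (periodic_int pphi) phiE /g reprK.
Qed.
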